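(* Every consistent atomic RCC8 network over $\{\mathbf{EC},\mathbf{TPP},\mathbf{TPP}^{-1},\mathbf{NTPP},\mathbf{NTPP}^{-1}\}$ has a convex solution in $\mathbb{R}^2$.
   Context: A region in $\mathbb{R}^n$ ($n\geq 1$) is a nonempty regular closed subset $X$, i.e. $X=\mathrm{cl}(\mathrm{int}(X))$; write $i(X)$ for the interior. The eight RCC8 base relations between regions $a,b$ (jointly exhaustive and pairwise disjoint; $\subset$ denotes proper inclusion) are: $a\,\mathbf{EQ}\,b$: $a=b$; $a\,\mathbf{DC}\,b$: $a\cap b=\emptyset$; $a\,\mathbf{EC}\,b$: $a\cap b\neq\emptyset$ and $i(a)\cap i(b)=\emptyset$; $a\,\mathbf{PO}\,b$: $i(a)\cap i(b)\neq\emptyset$, $a\not\subseteq b$, $b\not\subseteq a$; $a\,\mathbf{TPP}\,b$: $a\subset b$ and $a\not\subset i(b)$; $a\,\mathbf{NTPP}\,b$: $a\subset i(b)$; and the converses $\mathbf{TPP}^{-1}$, $\mathbf{NTPP}^{-1}$ of the last two. Let $V$ be a finite set of variables. An RCC8 constraint is an expression $u\,R\,v$ with $u,v\in V$ and $R$ a nonempty set of base relations; an RCC8 network is a set of such constraints. It is atomic if for every pair of distinct variables $u,v$ it contains a constraint $u\,R\,v$ or $v\,R\,u$ with $R$ a singleton. It is a network over a set $\mathcal{R}$ of base relations if every constraint $u\,R\,v$ in it has $R\subseteq\mathcal{R}$. An $n$-dimensional solution (solution in $\mathbb{R}^n$) of a network is a map $\mathcal{S}$ from $V$ to regions of $\mathbb{R}^n$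 such that for each constraint $u\,R\,v$ the base relation holding between $\mathcal{S}(u)$ and $\mathcal{S}(v)$ belongs to $R$. A network is consistent if it has a solution in $\mathbb{R}^n$ for some $n\geq 1$ (the regions need not be convex or connected). A solution is convex if every $\mathcal{S}(v)$ is a convex set. *)

(* Defs.v *)
From mathcomp Require Import all_boot all_order all_algebra.
From mathcomp Require Import all_classical all_reals all_analysis.

Set Implicit Arguments.
Unset Strict Implicit.
Unset Printing Implicit Defensive.

Import numFieldNormedType.Exports.

Local Open Scope classical_set_scope.
Local Open Scope ring_scope.

(* [TPPi] and [NTPPi] are the converses of [TPP] and [NTPP]. *)
Inductive rcc8 := EQ | DC | EC | PO | TPP | NTPP | TPPi | NTPPi.

Definition region (T : topologicalType) (X : set T) : Prop :=
  X !=set0 /\ regclosed X.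

Definition tpp (T : topologicalType) (a b : set T) : Prop :=
  a `<` b /\ ~ (a `<` interior b).

Definition ntpp (T : topologicalType) (a b : set T) : Prop :=
  a `<` interior b.

Definition rcc8_holds (T : topologicalType) (r : rcc8) (a b : set T) : Prop :=
  match r with
  | EQ => a = b
  | DC => a `&` b = set0
  | EC => a `&` b !=set0 /\ interior a `&` interior b = set0
  | PO => [/\ interior a `&` interior b !=set0, ~ (a `<=` b) & ~ (b `<=` a)]
  | TPP => tpp a b
  | NTPP => ntpp a b
  | TPPi => tpp b a
  | NTPPi => ntpp b a
  end.

Record rcc8_constraint (V : Type) := RCC8Constraint {
  lhs : V;
  rels : set rcc8;
  rhs : V;
  rels_nonempty : rels !=set0 }.

Definition rcc8_network (V : Type) := set (rcc8_constraint V).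

Definition atomic (V : Type) (N : rcc8_network V) : Prop :=
  forall u v : V, u <> v ->
    exists c, [/\ N c,
      (lhs c = u /\ rhs c = v) \/ (lhs c = v /\ rhs c = u) &
      exists r, rels c = [set r]].

Definition network_over (V : Type) (B : set rcc8) (N : rcc8_network V) : Prop :=
  forall c, N c -> rels c `<=` B.

(* ['rV[R]_n] carries the product topology of [R], i.e. the Euclidean one. *)
Definition solution (R : realType) (n : nat) (V : Type) (N : rcc8_network V)
    (S : V -> set 'rV[R]_n) : Prop :=
  (forall v, region (S v)) /\
  (forall c, N c -> exists2 r, rels c r & rcc8_holds r (S (lhs c)) (S (rhs c))).

Definition consistent (R : realType) (V : Type) (N : rcc8_network V) : Prop :=
  exists n : nat, (1 <= n)%N /\ exists S : V -> set 'rV[R]_n, solution N S.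

Definition convex_solution (R : realType) (n : nat) (V : Type)
    (N : rcc8_network V) (S : V -> set 'rV[R]_n) : Prop :=
  solution N S /\ forall v, convex_set (S v).

(* Main.v *)
Require Import Defs.
From mathcomp Require Import all_boot all_order all_algebra.
From mathcomp Require Import all_classical all_reals all_analysis.
From mathcomp Require Import ring lra zify.

(* In a consistent network of this kind any two regions are externally connected
   or nested, so inclusion is a forest, and a region that contains another as a
   non-tangential proper part is externally connected to nothing.

   Number the forest in postorder, so that the subtree of [u] receives the
   numbers in ]a u, b u], and attach to [k] the point (b k, b k ^ 2) of the
   parabola y = x^2. The region of [u] is a polygon whose sides are parallel to
   the tangents at these points: side [k] passes through point [k] if u = k or
   k TPP u, lies beyond it if k NTPP u, and cuts it off otherwise, always moving
   outwards with [u]. These tiny shifts realise all the inclusions, tangential or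
   not, because each point lies well inside the half-planes of the other tangents.
   If [u] is externally connected to something, the polygon is moreover cut down
   to the wedge a u * x <= y <= b u * x: disjoint subtrees get wedges with disjoint
   interiors, which all meet at the origin. *)

Set Implicit Arguments.
Unset Strict Implicit.
Unset Printing Implicit Defensive.

Import Order.TTheory GRing.Theory Num.Theory.
Import numFieldNormedType.Exports.

(** * Postorder numbering of a finite forest *)

Section Forest.
Variables (V : finType) (lt : rel V).
Hypotheses (lt_irr : irreflexive lt) (lt_trans : transitive lt).
Hypothesis lt_forest : forall u v w,
  lt u v -> lt u w -> [\/ v = w, lt v w | lt w v].

(** Serves as a rank: it grows strictly along [lt], so its maxima are maximal elements, and later it
    spaces out the shifts of the sides. *)
Definition height (v : V) : nat := #|[set w | lt w v]|.

Lemma height_lt u v : lt u v -> height u < height v.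
Proof.
move=> uv; apply/proper_card/fintype.properP; split.
  by apply/fintype.subsetP => w; rewrite !inE => /lt_trans; apply.
by exists u; rewrite !inE ?lt_irr.
Qed.

(** The intervals ][a u], [b u]] are half-open: disjoint ones may share an end, as the wedges only
    need disjoint interiors. Strictness of [b u < b v] helps to keep the touching points
    distinct. *)
Definition laminar (D : {set V}) (a b : V -> nat) : Prop :=
  forall u v, u \in D -> v \in D ->
    (lt u v -> a v <= a u /\ b u < b v) /\
    (u <> v -> ~~ lt u v -> ~~ lt v u -> b u <= a v \/ b v <= a u).

(* Split off a maximal element [m]: number what lies below it, then [m], then the
   rest, which by the forest property is incomparable to everything below [m]. *)
Lemma laminar_in (D : {set V}) (L : nat) :
  exists a b : V -> nat, exists M : nat,
    [/\ L <= M, forall u, u \in D -> [/\ L <= a u, a u < b u & b u <= M]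
      & laminar D a b].
Proof.
have [n] := ubnP #|D|; elim: n D L => // n IH D L Dn.
have [->|/set0Pn[m0 m0D]] := eqVneq D finset.set0.
  by exists (fun=> 0), (fun=> 0), L; split=> // [u|u v]; rewrite inE.
case: (arg_maxnP height m0D) => m mD m_max {m0 m0D}.
have max_m v : v \in D -> lt m v = false.
  by move=> vD; apply/negP => /height_lt; have /= := m_max v vD; lia.
pose D1 := [set u in D | lt u m].
pose D2 := [set u in D | ~~ lt u m & u != m].
have D1n : #|D1| < n.
  rewrite -ltnS; apply: leq_trans Dn; rewrite ltnS; apply/proper_card/fintype.properP; split.
    by apply/fintype.subsetP => w; rewrite !inE => /andP[].
  by exists m => //; rewrite !inE lt_irr andbF.
have D2n : #|D2| < n.
  rewrite -ltnS; apply: leq_trans Dn; rewrite ltnS; apply/proper_card/fintype.properP; split.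
    by apply/fintype.subsetP => w; rewrite !inE => /andP[].
  by exists m => //; rewrite !inE eqxx !andbF.
have [a1 [b1 [M1 [LM1 r1 l1]]]] := IH D1 L D1n.
(* Starting from [M1.+1] reserves that number for [b m]. *)
have [a2 [b2 [M2 [LM2 r2 l2]]]] := IH D2 M1.+1 D2n.
pose a u := if lt u m then a1 u else if u == m then L else a2 u.
pose b u := if lt u m then b1 u else if u == m then M1.+1 else b2 u.
have caseD u : u \in D -> [\/ u \in D1, u = m | u \in D2].
  move=> uD; rewrite !inE uD /=; case: (lt u m) => /=; first exact: Or31.
  by case: eqVneq => [->|_]; [exact: Or32|exact: Or33].
have D1E u : u \in D1 -> [/\ lt u m, a u = a1 u & b u = b1 u].
  by rewrite !inE => /andP[_ h]; rewrite /a /b h.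
have mE : a m = L /\ b m = M1.+1 by rewrite /a /b lt_irr eqxx.
have D2E u : u \in D2 -> [/\ lt u m = false, lt m u = false, a u = a2 u & b u = b2 u].
  rewrite !inE => /and3P[uD h h']; rewrite max_m // /a /b.
  by rewrite (negbTE h) (negbTE h').
have D12 u v : u \in D1 -> v \in D2 -> lt u v = false /\ lt v u = false.
  move=> /D1E[um _ _] vD2; have [vm mv _ _] := D2E v vD2; split.
    apply/negP => uv; have [e||] := lt_forest uv um; rewrite ?vm ?mv//.
    by move: vD2; rewrite e !inE eqxx !andbF.
  by apply/negP => vu; rewrite (lt_trans vu um) in vm.
exists a, b, M2; split; first by lia.
  move=> u /caseD[uD|->|uD].
  - by have [_ -> ->] := D1E u uD; have [? ? ?] := r1 u uD; split; lia.
  - by have [-> ->] := mE; split; lia.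
  - by have [_ _ -> ->] := D2E u uD; have [? ? ?] := r2 u uD; split; lia.
move=> u v /caseD[uD|->|uD] /caseD[vD|->|vD].
- have [_ -> ->] := D1E u uD; have [_ -> ->] := D1E v vD; exact: l1.
- have [-> -> ->] := D1E u uD; have [-> ->] := mE.
  by have [? ? ?] := r1 u uD; split=> //; lia.
- have [-> ->] := D12 u v uD vD; have [_ -> ->] := D1E u uD.
  have [_ _ -> ->] := D2E v vD.
  by have [? ? ?] := r1 u uD; have [? ? ?] := r2 v vD; split=> //; lia.
- have [-> -> ->] := D1E v vD; have [-> ->] := mE.
  split=> [mv|//].
  by have [/lt_trans/(_ mv)] := D1E v vD; rewrite lt_irr.
- by split=> //; rewrite lt_irr.
- have [-> -> -> ->] := D2E v vD; have [-> ->] := mE.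
  by have [? ? ?] := r2 v vD; split=> //; lia.
- have [-> ->] := D12 v u vD uD; have [_ -> ->] := D1E v vD.
  have [_ _ -> ->] := D2E u uD.
  by have [? ? ?] := r1 v vD; have [? ? ?] := r2 u uD; split=> //; lia.
- have [-> -> -> ->] := D2E u uD; have [-> ->] := mE.
  by have [? ? ?] := r2 u uD; split=> //; lia.
- have [_ _ -> ->] := D2E u uD; have [_ _ -> ->] := D2E v vD; exact: l2.
Qed.

End Forest.

Local Open Scope classical_set_scope.
Local Open Scope ring_scope.

(** * Polygons in the plane as intersections of half-planes *)

Lemma nbhs_segment (R : realType) (M : normedModType R) (x v : M) (A : set M) :
  nbhs x A -> exists s : R, [/\ 0 < s, s < 1 & A (x + s *: v)].
Proof.
move=> xA.
have cv : (fun s : R => x + s *: v) @ 0 --> x.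
  rewrite -[X in _ --> X]addr0 -[X in _ + X](scale0r v).
  by apply: cvgD; [exact: cvg_cst | apply: cvgZr_tmp; exact: cvg_id].
have /nbhs_ballP[e /= e0 eA] := cv _ xA.
exists (Num.min (e / 2) (1 / 2)); split.
- by rewrite lt_min; apply/andP; split; lra.
- by rewrite gt_min; apply/orP; right; lra.
apply: eA; rewrite /ball /= sub0r normrN gtr0_norm.
  by rewrite gt_min; apply/orP; left; lra.
by rewrite lt_min; apply/andP; split; lra.
Qed.

Section Polygon.
Variables (R : realType) (I : finType) (A B C : I -> R).

Definition slack (i : I) (p : 'rV[R]_2) := A i * p 0 0 + B i * p 0 1 + C i.

Definition polygon : set 'rV[R]_2 := [set p | forall i, 0 <= slack i p].

Lemma slack_continuous i : continuous (slack i).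
Proof.
move=> p.
have c j : (fun q : 'rV[R]_2 => q 0 j) @ nbhs p --> p 0 j.
  exact: coord_continuous.
apply: (@cvgD R R^o _ (nbhs p)); last exact: cvg_cst.
by apply: (@cvgD R R^o _ (nbhs p)); apply: cvgMl_tmp; exact: c.
Qed.

Lemma slack_line i p v s :
  slack i (p + s *: v) = slack i p + s * (A i * v 0 0 + B i * v 0 1).
Proof. by rewrite /slack !mxE; ring. Qed.

Lemma polygon_closed : closed polygon.
Proof.
have -> : polygon = \bigcap_i (slack i @^-1` [set x | 0 <= x]).
  by apply/seteqP; split => [p Pp i _|p Pp i]; [exact: Pp|exact: (Pp i)].
apply: closed_bigI => i _; apply: preimage_closed; last exact: closed_ge.
by move=> x _; exact: slack_continuous.
Qed.

Lemma interior_polygonI p : (forall i, 0 < slack i p) -> polygon° p.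
Proof.
move=> Pp; rewrite /interior.
have : \forall q \near p, forall i, 0 < slack i q.
  apply: (@filter_forall _ _ (fun i q => 0 < slack i q) (nbhs p)) => i.
  apply: (@cvgr_gt _ _ (nbhs p) _ (slack i) (slack i p)) => //.
  exact: slack_continuous.
by apply: filterS => q qP i; exact/ltW.
Qed.

(** A small move by a multiple of [- B i] in the y direction stays in the polygon and strictly
    decreases the slack. The y direction is enough because no genuine side of a cell is vertical. *)
Lemma interior_polygonE p i : polygon° p -> B i != 0 -> 0 < slack i p.
Proof.
move=> Pp Bi0.
have /(@nbhs_segment _ _ _ (- B i *: delta_mx 0 1))[s [s0 _ /(_ i)]] := Pp.
rewrite slack_line !mxE /= => h.
have : 0 < s * (B i * B i) by rewrite mulr_gt0// -expr2 exprn_even_gt0.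
by lra.
Qed.

(** Every point is a limit of interior ones: on the way towards [z] all slacks become positive. *)
Lemma polygon_region z : (forall i, 0 < slack i z) -> region polygon.
Proof.
move=> zP; split; first by exists z => i; exact/ltW.
rewrite /regclosed; apply/seteqP; split.
  rewrite [X in _ `<=` X](closure_id _).1; last exact: polygon_closed.
  exact: closureS (@interior_subset _ _).
move=> x xP U /(@nbhs_segment _ _ _ (z - x))[s [s0 s1 Us]].
exists (x + s *: (z - x)); split => //.
apply: interior_polygonI => i; rewrite slack_line.
have -> : A i * (z - x) 0 0 + B i * (z - x) 0 1 = slack i z - slack i x.
  by rewrite /slack !mxE; ring.
have := xP i; have := zP i; set a := slack i x; set b := slack i z => b0 a0.
have h1 : 0 < s * b by rewrite mulr_gt0.
have h2 : 0 <= (1 - s) * a by rewrite mulr_ge0//; lra.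
by lra.
Qed.

Lemma polygon_convex : convex_set polygon.
Proof.
move=> x y l; rewrite !inE => xP yP i.
have -> : slack i (conv l x y) = l%:num * slack i x + (1 - l%:num) * slack i y.
  by rewrite /slack !mxE /= /unstable.onem; ring.
by rewrite addr_ge0// mulr_ge0// ?subr_ge0.
Qed.

End Polygon.

(** * Regions and their proper parts in a topological space *)

Section Topology.
Variable T : topologicalType.
Implicit Types X Y Z U : set T.

Lemma region_interior X : region X -> X° !=set0.
Proof.
move=> [X0 rX]; apply/set0P/eqP => iX0; move: X0.
by rewrite -rX iX0 closure0 => -[x []].
Qed.

(** The source of the forest structure: two regions above a common one cannot be externally
    connected. *)
Lemma no_region_in_both X Y Z : region Z ->
  X° `&` Y° = set0 -> Z `<=` X -> Z `<=` Y -> False.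
Proof.
move=> /region_interior[z zZ] XY0 ZX ZY.
suff : (X° `&` Y°) z by rewrite XY0.
by split; [exact: interiorS ZX _ zZ|exact: interiorS ZY _ zZ].
Qed.

(** A point of [U] in [X] lies in the closure of the interior of [X], and [U] is a neighbourhood of
    it. *)
Lemma open_meets_interior X U : region X -> open U ->
  U `&` X !=set0 -> U `&` X° !=set0.
Proof.
move=> [_ rX] oU [x [Ux]]; rewrite -rX => /(_ U (open_nbhs_nbhs (conj oU Ux))).
by rewrite setIC rX.
Qed.

Lemma ntpp_proper X Y : ntpp X Y -> X `<` Y.
Proof.
move=> [XY YX]; split; first exact: subset_trans XY (@interior_subset _ _).
by move=> YX'; apply: YX; apply: subset_trans (@interior_subset _ _) YX'.
Qed.

Lemma proper_trans X Y Z : X `<` Y -> Y `<` Z -> X `<` Z.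
Proof.
move=> [XY YX] [YZ ZY]; split; first exact: subset_trans XY YZ.
by move=> ZX; apply: ZY; exact: subset_trans ZX XY.
Qed.

Lemma ntpp_proper_trans X Y Z : ntpp X Y -> Y `<` Z -> ntpp X Z.
Proof.
move=> [XY YX] [YZ ZY]; split; first exact: subset_trans XY (interiorS YZ).
by move=> ZX; apply: YX; apply: subset_trans ZX; exact: interiorS.
Qed.

Lemma proper_ntpp_trans X Y Z : X `<` Y -> ntpp Y Z -> ntpp X Z.
Proof.
exact: proper_trans.
Qed.

End Topology.

(** * Shifts of the sides along the inclusion order *)

Section Construction.
Variables (R : realType) (V : finType) (lt nt ec : rel V).
Hypotheses (lt_irr : irreflexive lt) (lt_trans : transitive lt).
Hypotheses (ec_sym : symmetric ec) (ec_irr : irreflexive ec).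
Hypothesis ec_lt : forall u v, ec u v -> lt u v = false.
Hypothesis ec_disjoint : forall u v w, ec v w -> lt u v -> lt u w -> False.
Hypothesis trichotomy : forall u v, u <> v -> [\/ ec u v, lt u v | lt v u].
Hypothesis ntW : forall u v, nt u v -> lt u v.
Hypothesis nt_lt_trans : forall u v w, nt u v -> lt v w -> nt u w.
Hypothesis lt_nt_trans : forall u v w, lt u v -> nt v w -> nt u w.
Hypothesis nt_ec : forall u v w, nt u v -> ec v w -> False.

Lemma lt_forest u v w : lt u v -> lt u w -> [\/ v = w, lt v w | lt w v].
Proof.
move=> uv uw; have [->|/eqP/trichotomy[vw|vw|wv]] := eqVneq v w.
- exact: Or31.
- by have := ec_disjoint vw uv uw.
- exact: Or32.
- exact: Or33.
Qed.

(** In general a part of [v] may be disjoint from [w]; here [trichotomy] rules this out, and an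
    inclusion between [u] and [w] would contradict [ec v w]. So [wedged] below is inherited by
    parts. *)
Lemma ec_down u v w : lt u v -> ec v w -> ec u w.
Proof.
move=> uv vw; have [uw|/eqP/trichotomy[//|uw|wu]] := eqVneq u w.
- by move: vw; rewrite ec_sym => /ec_lt; rewrite -uw uv.
- by have := ec_disjoint vw uv uw.
- by move: vw; rewrite ec_sym => /ec_lt; rewrite (lt_trans wu uv).
Qed.

(** Large enough for the last case of [offset] to be negative and for all shifts to be at most 1/2
    in absolute value. *)
Let M := #|V|.+2.

(* [offset k v] is how far the side of [v] facing the touching point of [k]
   is pushed outwards, in units of [1 / 2 M]: it vanishes exactly when [v]
   has to pass through that point. *)
Definition offset (k v : V) : R :=
  if nt k v then (height lt v).+1%:R
  else if (v == k) || lt k v then 0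
  else (height lt v).+1%:R - M%:R.

Lemma height_bound v : ((height lt v).+1 < M)%N.
Proof. by rewrite !ltnS max_card. Qed.

Lemma offset_bound k v : - M%:R <= offset k v <= M%:R.
Proof.
have := height_bound v; rewrite -(ltr_nat R) /offset => h.
have h0 := ler0n R (height lt v).+1.
by case: ifP => _; [|case: ifP => _]; apply/andP; split; lra.
Qed.

Lemma offset_diag v : offset v v = 0.
Proof. by rewrite /offset eqxx; case: ifP => // /ntW; rewrite lt_irr. Qed.

Lemma offset_tangent u v : lt u v -> ~~ nt u v -> offset u v = 0.
Proof. by move=> uv /negbTE nuv; rewrite /offset nuv uv orbT. Qed.

Lemma offset_below u v : lt u v -> offset v u < 0.
Proof.
move=> uv; rewrite /offset; case: ifP => [/ntW/lt_trans/(_ uv)|_].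
  by rewrite lt_irr.
case: ifP => [/orP[/eqP uv'|/lt_trans/(_ uv)]|_]; rewrite ?lt_irr//.
  by move: uv; rewrite uv' lt_irr.
by rewrite subr_lt0 ltr_nat height_bound.
Qed.

(** From [u] to [v] the case can only change upwards (negative, zero, positive), and within a
    nonzero case the height grows. *)
Lemma offset_le k u v : lt u v -> offset k u <= offset k v.
Proof.
move=> uv; have := height_lt lt_irr lt_trans uv; rewrite -ltnS -(ltr_nat R).
have := height_bound u; rewrite -(ltr_nat R).
have := ler0n R (height lt v).+1.
rewrite /offset; case: ifP => [ku|_]; first by rewrite (nt_lt_trans ku uv); lra.
have [<-|uk] /= := eqVneq u k; first by rewrite uv orbT; case: ifP => _; lra.
case: ifP => [ku|_]; first by rewrite (lt_trans ku uv) orbT; case: ifP; lra.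
by case: ifP => _; [lra|case: ifP => _; lra].
Qed.

(** The offset cannot stay zero: if [k] is [u] or lies below it, then [nt k v]. *)
Lemma offset_lt k u v : nt u v -> offset k u < offset k v.
Proof.
move=> uv; have := height_lt lt_irr lt_trans (ntW uv); rewrite -ltnS -(ltr_nat R).
have := height_bound u; rewrite -(ltr_nat R).
have := ltr0Sn R (height lt v).
rewrite /offset; case: ifP => [ku|_].
  by rewrite (nt_lt_trans ku (ntW uv)); lra.
have [<-|uk] /= := eqVneq u k; first by rewrite uv.
case: ifP => [ku|_]; first by rewrite (lt_nt_trans ku uv).
by case: ifP => _; [lra|case: ifP => _; lra].
Qed.

Definition shift k v : R := offset k v / (2 * M%:R).

Let M0 : 0 < 2 * M%:R :> R.
Proof. by rewrite mulr_gt0. Qed.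

(** The bound 1/2 is harmless: the apex and the touching points other than that of [k] have slack at
    least 1 for the tangent of [k]. *)
Lemma shift_bound k v : - (1 / 2) <= shift k v <= 1 / 2.
Proof.
have /andP[h1 h2] := offset_bound k v.
by rewrite /shift ler_pdivrMr// ler_pdivlMr//; apply/andP; split; lra.
Qed.

Lemma shift_le k u v : lt u v -> shift k u <= shift k v.
Proof. by move=> uv; rewrite ler_pM2r ?invr_gt0// offset_le. Qed.

Lemma shift_lt k u v : nt u v -> shift k u < shift k v.
Proof. by move=> uv; rewrite ltr_pM2r ?invr_gt0// offset_lt. Qed.

(** * Cells built from a laminar numbering *)

Variables (a b : V -> nat).
Hypothesis ab : forall u, (a u < b u)%N.
Hypothesis ab_laminar : laminar lt finset.setT a b.

Lemma b_inj : injective b.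
Proof.
move=> u v buv; have [//|/eqP uv] := eqVneq u v; exfalso; have := ab u.
have [uv1 uv2] := ab_laminar (finset.in_setT u) (finset.in_setT v).
have [vu1 _] := ab_laminar (finset.in_setT v) (finset.in_setT u).
have := ab v; case/boolP: (lt u v) uv2 => [/uv1 ? _|_]; first by lia.
by case/boolP: (lt v u) => [/vu1 ? _|_ /(_ uv erefl erefl)]; lia.
Qed.

Definition wedged u := [exists v, ec u v].

(* The sides [inl k] are parallel to the tangents of the parabola [y = x^2];
   the sides [inr _] bound a wedge with apex at the origin, and degenerate to
   the trivial constraint [0 <= 1] unless [wedged u]. *)
Definition side_x u (i : V + bool) : R :=
  match i with
  | inl k => - 2 * (b k)%:R
  | inr false => if wedged u then - (a u)%:R else 0
  | inr true => if wedged u then (b u)%:R else 0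
  end.

Definition side_y u (i : V + bool) : R :=
  match i with
  | inl k => 1
  | inr false => if wedged u then 1 else 0
  | inr true => if wedged u then - 1 else 0
  end.

Definition side_0 u (i : V + bool) : R :=
  match i with
  | inl k => (b k)%:R ^+ 2 + shift k u
  | inr _ => if wedged u then 0 else 1
  end.

Definition cell u := polygon (side_x u) (side_y u) (side_0 u).

(** Signed vertical distance from [p] to the tangent of y = x^2 at x = [b k]. *)
Definition tangent_slack k (p : 'rV[R]_2) : R :=
  p 0 1 - 2 * (b k)%:R * p 0 0 + (b k)%:R ^+ 2.

Lemma cellE u p : cell u p <->
  (forall k, 0 <= tangent_slack k p + shift k u) /\
  (wedged u -> (a u)%:R * p 0 0 <= p 0 1 <= (b u)%:R * p 0 0).
Proof.
rewrite /cell /polygon /slack /tangent_slack /=; split=> [h|[h1 h2] [k|[]]].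
- split=> [k|wu]; first by have /= := h (inl k); lra.
  by have /= := h (inr true); have /= := h (inr false); rewrite wu; lra.
- by have := h1 k; rewrite /=; lra.
- by move: h2; rewrite /=; case: (wedged u) => [/(_ isT)|_]; lra.
- by move: h2; rewrite /=; case: (wedged u) => [/(_ isT)|_]; lra.
Qed.

Lemma cell_strict u p :
  (forall k, 0 < tangent_slack k p + shift k u) ->
  (wedged u -> (a u)%:R * p 0 0 < p 0 1 < (b u)%:R * p 0 0) ->
  forall i, 0 < slack (side_x u) (side_y u) (side_0 u) i p.
Proof.
rewrite /slack /tangent_slack => h1 h2 [k|[]] /=.
- by have := h1 k; lra.
- by move: h2; case: (wedged u) => [/(_ isT)|_]; lra.
- by move: h2; case: (wedged u) => [/(_ isT)|_]; lra.
Qed.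

Lemma interior_cellE u p : (cell u)° p ->
  (forall k, 0 < tangent_slack k p + shift k u) /\
  (wedged u -> (a u)%:R * p 0 0 < p 0 1 < (b u)%:R * p 0 0).
Proof.
move=> pu; rewrite /tangent_slack; split=> [k|wu].
  by have := interior_polygonE (i := inl k) pu (oner_neq0 _); rewrite /slack /=; lra.
have h0 := interior_polygonE (i := inr false) pu.
have h1 := interior_polygonE (i := inr true) pu.
move: h0 h1; rewrite /slack /= wu oppr_eq0 oner_eq0 => /(_ isT) + /(_ isT).
by lra.
Qed.

Definition point (x y : R) : 'rV[R]_2 := \row_j (if j == 0 then x else y).

Definition touching u := point (b u)%:R ((b u)%:R ^+ 2).

Lemma tangent_slack_touching k u :
  tangent_slack k (touching u) = ((b u)%:R - (b k)%:R) ^+ 2.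
Proof. by rewrite /tangent_slack !mxE /=; ring. Qed.

Lemma b_ge1 u : 1 <= (b u)%:R :> R.
Proof. by rewrite ler1n; have := ab u; lia. Qed.

(** The point lies on the upper side y = [b u] x of its own wedge and on its own tangent, whose
    shift is 0; the other tangents are too far away to cut it off. *)
Lemma touching_cell u : cell u (touching u).
Proof.
apply/cellE; split=> [k|_]; last first.
  rewrite !mxE /= expr2 lexx andbT ler_wpM2r// ler_nat; exact/ltnW.
rewrite tangent_slack_touching; have [->|ku] := eqVneq k u.
  by rewrite subrr expr0n /= add0r /shift offset_diag mul0r.
have : 1 <= ((b u)%:R - (b k)%:R) ^+ 2 :> R.
  have : b k <> b u by move=> /b_inj; exact/eqP.
  move=> /eqP; rewrite neq_ltn => /orP[]; rewrite -(ler_nat R) -addn1 natrD;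
    by nra.
by have := shift_bound k u; lra.
Qed.

Lemma touching_not_interior u v : lt u v -> ~~ nt u v ->
  ~ (cell v)° (touching u).
Proof.
move=> uv nuv /interior_cellE[/(_ u) + _].
by rewrite tangent_slack_touching /shift offset_tangent// mul0r subrr expr0n /= addr0 ltxx.
Qed.

Lemma touching_outside_smaller u v : lt u v -> ~ cell u (touching v).
Proof.
move=> uv /cellE[/(_ v) + _]; rewrite tangent_slack_touching subrr expr0n /= add0r.
by rewrite leNgt /shift pmulr_llt0 ?invr_gt0// offset_below.
Qed.

Lemma apex_cell u : cell u (point 0 0).
Proof.
apply/cellE; split=> [k|_]; last by rewrite !mxE /= !mulr0 lexx.
rewrite /tangent_slack !mxE /=.
by have := b_ge1 k; have := shift_bound k u; nra.
Qed.

Lemma apex_not_interior u : wedged u -> ~ (cell u)° (point 0 0).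
Proof. by move=> wu /interior_cellE[_ /(_ wu)]; rewrite !mxE /= !mulr0 ltxx. Qed.

Lemma cell_region u : region (cell u).
Proof.
pose m : R := ((a u)%:R + (b u)%:R) / 2.
(* A point on the line of slope [m], strictly inside the wedge; its tangent slack (b k)^2 - (b k)/2
   + m/4 exceeds 1/2. *)
apply: (@polygon_region _ _ _ _ _ (point (1 / 4) (m / 4))).
have abR : (a u)%:R < (b u)%:R :> R by rewrite ltr_nat.
have a0 : 0 <= (a u)%:R :> R by [].
apply: cell_strict => [k|_]; last by rewrite !mxE /= /m; apply/andP; split; lra.
rewrite /tangent_slack !mxE /= /m.
by have := b_ge1 k; have := shift_bound k u; nra.
Qed.

Lemma cell_proper u v : lt u v -> cell u `<` cell v.
Proof.
move=> uv; split; last first.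
  by move=> /(_ _ (touching_cell v)); exact: touching_outside_smaller.
move=> p /cellE[pu wu]; apply/cellE; split=> [k|wv].
  by have := pu k; have := shift_le k uv; lra.
(* As [a u < b u], the wedge lies in x >= 0, where nested slope intervals give nested wedges. *)
have {}wu : wedged u -> 0 <= p 0 0 /\ (a u)%:R * p 0 0 <= p 0 1 <= (b u)%:R * p 0 0.
  move=> /wu h; split=> //; have : (a u)%:R < (b u)%:R :> R by rewrite ltr_nat.
  by nra.
have /wu[x0 {}wu] : wedged u.
  by have /existsP[w vw] := wv; apply/existsP; exists w; exact: ec_down vw.
have [/(_ uv)[]] := ab_laminar (finset.in_setT u) (finset.in_setT v).
move=> + /ltnW; rewrite -!(ler_nat R) => aa bb _.
by nra.
Qed.

(** By [nt_ec] the cell of [v] has no wedge, and each of its tangent sides lies strictly outside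
    that of [u]. *)
Lemma cell_ntpp u v : nt u v -> ntpp (cell u) (cell v).
Proof.
move=> uv; have [cuv cvu] := cell_proper (ntW uv); split.
  move=> p /cellE[pu _]; apply: interior_polygonI; apply: cell_strict => [k|].
    by have := pu k; have := shift_lt k uv; lra.
  by move=> /existsP[w /(nt_ec uv)].
(* If the interior of [cell v] were inside the closed set [cell u], so would be its closure, which
   is [cell v]. *)
move=> ivu; apply: cvu; have [_ <-] := cell_region v.
rewrite [X in _ `<=` X](closure_id _).1; last exact: polygon_closed.
exact: closureS.
Qed.

Lemma cell_tpp u v : lt u v -> ~~ nt u v -> tpp (cell u) (cell v).
Proof.
move=> uv nuv; split; first exact: cell_proper.
by move=> [/(_ _ (touching_cell u))/(touching_not_interior uv nuv)].
Qed.

Lemma cell_ec u v : ec u v -> rcc8_holds EC (cell u) (cell v).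
Proof.
move=> uv; split; first by exists (point 0 0); split; exact: apex_cell.
apply/seteqP; split=> // p [/interior_cellE[_ pu] /interior_cellE[_ pv]].
have {}pu : (a u)%:R * p 0 0 < p 0 1 < (b u)%:R * p 0 0.
  by apply: pu; apply/existsP; exists v.
have {}pv : (a v)%:R * p 0 0 < p 0 1 < (b v)%:R * p 0 0.
  by apply: pv; apply/existsP; exists u; rewrite ec_sym.
have abR : (a u)%:R < (b u)%:R :> R by rewrite ltr_nat.
(* With x > 0 the slope y / x would lie in two disjoint open intervals. *)
have x0 : 0 < p 0 0 by nra.
have [_] := ab_laminar (finset.in_setT u) (finset.in_setT v).
rewrite ec_lt// ec_lt 1?ec_sym// => -[||||].
- by move=> uv'; move: uv; rewrite uv' ec_irr.
- by [].
- by [].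
- by rewrite -(ler_nat R) /=; nra.
- by rewrite -(ler_nat R) /=; nra.
Qed.

End Construction.

(** * Transfer of an arbitrary solution to the plane *)

Theorem proposition10 (R : realType) (V : finType) (N : rcc8_network V)
    (N_consistent : consistent R N) (N_atomic : atomic N)
    (N_over : network_over [set EC; TPP; TPPi; NTPP; NTPPi] N) :
  exists S : V -> set 'rV[R]_2, convex_solution N S.
Proof.
have [n [_ [X [X_region X_sol]]]] := N_consistent.
(* The given solution enters the construction only through these three relations. *)
pose lt u v := `[< X u `<` X v >].
pose nt u v := `[< ntpp (X u) (X v) >].
pose ec u v := `[< rcc8_holds EC (X u) (X v) >].
have not_both u v w : ec v w -> X u `<=` X v -> X u `<=` X w -> False.
  by move=> /asboolP[_ ivw]; exact: no_region_in_both.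
have ec_sym : symmetric ec.
  by move=> u v; apply/asboolP/asboolP => -[h1 h2]; split; rewrite setIC.
have lt_irr : irreflexive lt by move=> u; apply/asboolP => -[].
have lt_trans : transitive lt.
  by move=> v u w /asboolP uv /asboolP vw; apply/asboolP; exact: proper_trans vw.
have ec_irr : irreflexive ec.
  by move=> u; apply/negP => uu; exact: (not_both u u u).
have ec_lt u v : ec u v -> lt u v = false.
  by move=> uv; apply/asboolP => -[+ _]; exact: not_both uv _.
have ec_disjoint u v w : ec v w -> lt u v -> lt u w -> False.
  by move=> vw /asboolP[uv _] /asboolP[uw _]; exact: (not_both u v w).
have ntW u v : nt u v -> lt u v.
  by move=> /asboolP uv; apply/asboolP; exact: ntpp_proper.
have trichotomy u v : u <> v -> [\/ ec u v, lt u v | lt v u].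
  move=> /N_atomic[c [Nc cuv [r cr]]]; have [s] := X_sol c Nc.
  have := N_over c Nc; rewrite cr => /(_ r erefl) /= rB -> {s cr} cX.
  have {cX} : [\/ ec (lhs c) (rhs c), lt (lhs c) (rhs c) | lt (rhs c) (lhs c)].
    move: rB cX => [[[[]|]|]|] -> /=.
    - by move=> h; apply: Or31; apply/asboolP.
    - by move=> [h _]; apply: Or32; apply/asboolP.
    - by move=> [h _]; apply: Or33; apply/asboolP.
    - by move=> h; apply: Or32; apply: ntW; apply/asboolP.
    - by move=> h; apply: Or33; apply: ntW; apply/asboolP.
  case: cuv => -[-> ->] // [h|h|h]; [|exact: Or33|exact: Or32].
  by apply: Or31; rewrite ec_sym.
have nt_lt_trans u v w : nt u v -> lt v w -> nt u w.
  move=> /asboolP uv /asboolP vw; apply/asboolP; exact: ntpp_proper_trans vw.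
have lt_nt_trans u v w : lt u v -> nt v w -> nt u w.
  move=> /asboolP uv /asboolP vw; apply/asboolP; exact: proper_ntpp_trans vw.
(* By [ec_down], [X u] meets [X w], and it does so inside the interior of [X v]; as [X w] is regular
   closed, the interiors of [X v] and [X w] would then meet. *)
have nt_ec u v w : nt u v -> ec v w -> False.
  move=> uv vw; have /asboolP[Xuv _] := uv.
  have : ec u w by apply: (ec_down lt_trans ec_sym) vw => //; exact: ntW.
  move=> /asboolP[[x [xu xw]] _]; have /asboolP[_ ivw] := vw.
  have [|y] := open_meets_interior (X_region w) (@open_interior _ (X v)).
    by exists x; split => //; exact: Xuv.
  by rewrite ivw.
have forest := lt_forest ec_disjoint trichotomy.
have [a [b [M [_ ab ab_laminar]]]] := laminar_in lt_irr lt_trans forest finset.setT 0.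
have {}ab u : (a u < b u)%N by have [] := ab u (finset.in_setT u).
pose S : V -> set 'rV[R]_2 := cell lt nt ec a b.
exists S; split; last by move=> v; exact: polygon_convex.
have tppP u v : tpp (X u) (X v) -> tpp (S u) (S v).
  move=> [uv nuv]; apply: cell_tpp => //; first exact/asboolP.
  exact/asboolP.
have ntppP u v : ntpp (X u) (X v) -> ntpp (S u) (S v).
  by move=> uv; apply: cell_ntpp => //; exact/asboolP.
split=> [v|c Nc]; first exact: cell_region.
(* [S] realises the very base relation that [X] does, so constraints with several relations are
   covered too. *)
have [r rc cX] := X_sol c Nc; exists r => //.
move: (N_over c Nc r rc) cX => /= [[[[]|]|]|] ->.
- by move=> h; apply: cell_ec => //; exact/asboolP.
- exact: tppP.
- exact: tppP.
- exact: ntppP.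
- exact: ntppP.
Qed.
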